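(* Let $\mathcal{L}=(\bm{X},\bm{E},\bm{F},\mathbb{P}_{\bm{E}})$ and $\mathcal{H}=(\bm{Y},\bm{U},\bm{G},\mathbb{P}_{\bm{U}})$ be structural causal models and $\mathcal{I}$ and $\mathcal{J}$ their corresponding sets of admissible (soft) interventions. Whenever $\mathcal{H}$ is a soft $\tau$-abstraction of $\mathcal{L}$ with alignment $\Pi$, the intervention map $\omega\colon\mathcal{I}\to\mathcal{J}$ maps each low-level intervention $i=(\bm{V}\gets\bm{f})\in\mathcal{I}$ to an intervention $j=(\bm{W}\gets\bm{g})$ on high-level variables $$\bm{W}\subseteq\{Y\in\bm{Y}\mid\bm{V}\cap\Pi(Y)\neq\emptyset\}$$ such that, for any variable $Y\in\bm{W}$, all $\bm{y}\in\mathrm{Val}(\bm{Y})$ and $\bm{u}\in\mathrm{Val}(\bm{U})$, and any partial inverses $\tau_{\bm{Y}}^{-1}$ and $\tau_{\bm{U}}^{-1}$, $$g_Y(\bm{y},\bm{u})=\tau_Y\left(F^i_{\Pi(Y)}\left(\tau_{\bm{Y}}^{-1}(\bm{y}),\tau_{\bm{U}}^{-1}(\bm{u})\right)\right).$$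
   Context: Each variable $V$ has a domain $\mathrm{Val}(V)$; for a set $\bm{V}$ of variables, $\mathrm{Val}(\bm{V})=\prod_{V\in\bm{V}}\mathrm{Val}(V)$. For $\bm{V}\subseteq\bm{X}$ and $\bm{x}\in\mathrm{Val}(\bm{X})$, $\mathrm{Proj}(\bm{x},\bm{V})\in\mathrm{Val}(\bm{V})$ is the restriction of $\bm{x}$ to the variables $\bm{V}$. A structural causal model (SCM) is a tuple $\mathcal{M}=(\bm{X},\bm{E},\bm{F},\mathbb{P}_{\bm{E}})$ with endogenous variables $\bm{X}$, exogenous variables $\bm{E}$, a family $\bm{F}$ of structural equations $F_X\colon\mathrm{Val}(\bm{X})\times\mathrm{Val}(\bm{E})\to\mathrm{Val}(X)$, $X\in\bm{X}$, and a probability measure $\mathbb{P}_{\bm{E}}$ on $\mathrm{Val}(\bm{E})$. $F_X$ depends only on a subset $\mathrm{Pa}(X)\subseteq\bm{X}\cup\bm{E}$ of variables, the parents of $X$. Standing assumption: for every SCM, including those produced by interventions, endogenous settings are fully determined by exogenous settings (the structural equations have a unique solution for each exogenous setting). A soft intervention $i=(\bm{V}\gets\bm{f})$ on $\mathcal{M}$, with $\bm{V}\subseteq\bm{X}$ and $\bm{f}=(f_X)_{X\in\bm{V}}$, $f_X\colon\mathrm{Val}(\bm{X})\times\mathrm{Val}(\bm{E})\to\mathrm{Val}(X)$ depending at most on $\mathrm{Pa}(X)$, produces the SCM $\mathcal{M}_i=(\bm{X},\bm{E},\bm{F}^i,\mathbb{P}_{\bm{E}})$ with $F^i_X=f_X$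 if $X\in\bm{V}$ and $F^i_X=F_X$ otherwise. Hard interventions are the special case in which all $f_X$ are constant. Two interventions on a model are not regarded as distinct when they yield the same structural equations (equal outputs on all inputs); in particular a variable whose structural equation is left unchanged counts as not intervened. Viewing $\bm{f}$ as a joint function $\mathrm{Val}(\bm{X})\times\mathrm{Val}(\bm{E})\to\mathrm{Val}(\bm{V})$, the soft restriction set of an intervention $i=(\bm{V}\gets\bm{f})$ is $$\mathrm{SoftRst}(\mathcal{M}_i)=\{\bm{x}\in\mathrm{Val}(\bm{X})\mid\mathrm{Proj}(\bm{x},\bm{V})\in\mathrm{Image}(\bm{f})\}.$$ The family $\bm{F}^i$ is also viewed as a joint function $\mathrm{Val}(\bm{X})\times\mathrm{Val}(\bm{E})\to\mathrm{Val}(\bm{X})$, and for $\bm{Z}\subseteq\bm{X}$, $F^i_{\bm{Z}}=(F^i_X)_{X\in\bm{Z}}\colon\mathrm{Val}(\bm{X})\times\mathrm{Val}(\bm{E})\to\mathrm{Val}(\bm{Z})$. Soft abstraction: let $\tau_{\bm{Y}}\colon\mathrm{Val}(\bm{X})\to\mathrm{Val}(\bm{Y})$ and $\tau_{\bm{U}}\colon\mathrm{Val}(\bm{E})\to\mathrm{Val}(\bm{U})$ be surjective. $\mathcal{H}$ is a soft $\tau$-abstraction of $\mathcal{L}$ if there exists a surjective function $\omega\colon\mathcal{I}\to\mathcal{J}$ (the intervention map) such that for every $i\in\mathcal{I}$ $$\mathrm{SoftRst}(\mathcal{H}_{\omega(i)})=\{\tau_{\bm{Y}}(\bm{x})\mid\bm{x}\in\mathrm{SoftRst}(\mathcal{L}_i)\}$$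 and, for all $\bm{e}\in\mathrm{Val}(\bm{E})$ and $\bm{x}\in\mathrm{Val}(\bm{X})$, $\tau_{\bm{Y}}(\bm{F}^i(\bm{x},\bm{e}))=\bm{G}^{\omega(i)}(\tau_{\bm{Y}}(\bm{x}),\tau_{\bm{U}}(\bm{e}))$. Alignment: if $\mathcal{H}$ is a soft $\tau$-abstraction of $\mathcal{L}$, an alignment is a map $\Pi\colon\bm{Y}\cup\bm{U}\to\mathcal{P}(\bm{X}\cup\bm{E})$ (power set) such that (1) for each $Y\in\bm{Y}$, $\Pi(Y)\subseteq\bm{X}$ and there is a function $\tau_Y\colon\mathrm{Val}(\Pi(Y))\to\mathrm{Val}(Y)$ with $\mathrm{Proj}(\tau_{\bm{Y}}(\bm{x}),Y)=\tau_Y(\mathrm{Proj}(\bm{x},\Pi(Y)))$ for all $\bm{x}\in\mathrm{Val}(\bm{X})$; (2) for each $U\in\bm{U}$, $\Pi(U)\subseteq\bm{E}$ and there is a function $\tau_U\colon\mathrm{Val}(\Pi(U))\to\mathrm{Val}(U)$ with $\mathrm{Proj}(\tau_{\bm{U}}(\bm{e}),U)=\tau_U(\mathrm{Proj}(\bm{e},\Pi(U)))$ for all $\bm{e}\in\mathrm{Val}(\bm{E})$. The sets $\Pi(\cdot)$ need not be disjoint. A partial inverse $\tau^{-1}$ of a surjective map $\tau$ is a function with $\tau(\tau^{-1}(\bm{y}))=\bm{y}$ for all $\bm{y}$ in the codomain.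
   Formalization: The inclusion for W is proved under the added assumption that the unintervened models satisfy the commutation condition τ_Y(F(x,e)) = G(τ_Y(x),τ_U(e)); without it the inclusion can fail, as ω may send the empty intervention to a nonempty one. The formula for g_Y needs no extra assumption. *)

(* Defs.v *)
From mathcomp Require Import all_boot all_order all_algebra.
From mathcomp Require Import all_classical all_reals.
From mathcomp Require Import measure.

Set Implicit Arguments.
Unset Strict Implicit.
Unset Printing Implicit Defensive.

Local Open Scope classical_set_scope.

(* For a family of domains [D] indexed by variables [T], a setting of all the
   variables is an element of [forall X : T, D X]; a setting of the variables
   in [V : set T] is an element of [setting D V]. *)
Definition setting (T : Type) (D : T -> Type) (V : set T) : Type :=
  forall X : V, D (sval X).

Definition proj_on (T : Type) (D : T -> Type) (x : forall X, D X) (V : set T) :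
  setting D V := fun X => x (sval X).
Arguments proj_on {T D} x V X.

Definition surjective (A B : Type) (f : A -> B) : Prop :=
  set_surj [set: A] [set: B] f.

(* [f x e] is determined by the restriction of [x] and [e] to the variables
   in [P]. *)
Definition depends_only (T S : Type) (DT : T -> Type) (DS : S -> Type)
    (C : Type) (f : (forall X, DT X) -> (forall E, DS E) -> C)
    (P : set (T + S)) : Prop :=
  forall x x' e e',
    (forall X, P (inl X) -> x X = x' X) ->
    (forall E, P (inr E) -> e E = e' E) ->
    f x e = f x' e'.

Definition uniquely_solvable (T S : Type) (DT : T -> Type) (DS : S -> Type)
    (F : forall X, (forall Y, DT Y) -> (forall E, DS E) -> DT X) : Prop :=
  forall e, exists! x, forall X, x X = F X x e.

(* The probability measure lives on the sigma-algebra generated by [events],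
   an arbitrary family of sets of exogenous settings.  Domains of exogenous
   variables are pointed because the library's measurable types are; this
   loses nothing, as a probability space is nonempty. *)
Record scm (R : realType) := Scm {
  endo : Type;
  exo : Type;
  endo_dom : endo -> Type;
  exo_dom : exo -> pointedType;
  events : set (set (forall E, exo_dom E));
  prob : probability (g_sigma_algebraType events) R;
  struct_eqn : forall X,
    (forall Y, endo_dom Y) -> (forall E, exo_dom E) -> endo_dom X;
  parents : endo -> set (endo + exo);
  eqn_parents : forall X, depends_only (struct_eqn X) (parents X);
  eqn_solvable : uniquely_solvable struct_eqn
}.

Definition val_endo (R : realType) (M : scm R) : Type :=
  forall X : endo M, endo_dom X.
Definition val_exo (R : realType) (M : scm R) : Type :=
  forall E : exo M, exo_dom E.

Definition joint_eqn (R : realType) (M : scm R) (x : val_endo M)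
  (e : val_exo M) : val_endo M := fun X => struct_eqn X x e.
Arguments joint_eqn {R} M x e.

Definition override (R : realType) (M : scm R) (V : set (endo M))
    (f : forall X : V, val_endo M -> val_exo M -> endo_dom (sval X))
    (X : endo M) : val_endo M -> val_exo M -> endo_dom X :=
  match pselect (X \in V) with
  | left XV => f (exist _ X XV)
  | right _ => struct_eqn X
  end.

Arguments override {R M V} f X.

(* [mech_changed]: a variable whose equation is left unchanged is not
   intervened upon.  Every intervention is thus in normal form, and distinct
   interventions yield distinct structural equations. *)
Record soft_intervention (R : realType) (M : scm R) := SoftIntervention {
  target : set (endo M);
  mech : forall X : target, val_endo M -> val_exo M -> endo_dom (sval X);
  mech_parents : forall X : target, depends_only (mech X) (parents (sval X));
  mech_changed : forall X : target,
    exists x e, mech X x e <> struct_eqn (sval X) x e;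
  mech_solvable : uniquely_solvable (override mech)
}.

Arguments mech {R M} i X : rename.

Lemma override_parents (R : realType) (M : scm R) (i : soft_intervention M)
    (X : endo M) :
  depends_only (override (mech i) X) (parents X).
Proof.
rewrite /override; case: pselect => [XV|_]; last exact: eqn_parents.
exact: (@mech_parents R M i (exist _ X XV)).
Qed.

Definition intervene (R : realType) (M : scm R) (i : soft_intervention M) :
    scm R :=
  {| endo := endo M; exo := exo M;
     endo_dom := @endo_dom R M; exo_dom := @exo_dom R M;
     events := @events R M; prob := prob M;
     struct_eqn := override (mech i);
     parents := @parents R M;
     eqn_parents := override_parents i;
     eqn_solvable := mech_solvable i |}.

Definition joint_mech (R : realType) (M : scm R) (i : soft_intervention M)
    (xe : val_endo M * val_exo M) : setting (@endo_dom R M) (target i) :=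
  fun X => mech i X xe.1 xe.2.
Arguments joint_mech {R M} i xe X.

Definition soft_rst (R : realType) (M : scm R) (i : soft_intervention M) :
    set (val_endo M) :=
  [set x | proj_on x (target i) \in range (joint_mech i)].

(* [H] is a soft abstraction of [L] for [tauY] and [tauU], with [omega] as the
   witnessing intervention map. *)
Definition soft_abstraction_by (R : realType) (L H : scm R)
    (I : set (soft_intervention L)) (J : set (soft_intervention H))
    (tauY : val_endo L -> val_endo H) (tauU : val_exo L -> val_exo H)
    (omega : I -> J) : Prop :=
  [/\ surjective tauY,
      surjective tauU,
      surjective omega,
      forall i : I,
        soft_rst (sval (omega i)) = [set tauY x | x in soft_rst (sval i)] &
      forall (i : I) (e : val_exo L) (x : val_endo L),
        tauY (joint_eqn (intervene (sval i)) x e) =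
        joint_eqn (intervene (sval (omega i))) (tauY x) (tauU e)].

(* The models themselves, without intervention, satisfy the commutation
   condition of a soft abstraction.  This does not follow from
   [soft_abstraction_by], which allows [omega] to send the empty intervention
   to a nonempty one with full range; if the empty intervention of [L] is
   admissible, it says that [omega] sends it to the empty intervention. *)
Definition commutes_unintervened (R : realType) (L H : scm R)
    (tauY : val_endo L -> val_endo H) (tauU : val_exo L -> val_exo H) : Prop :=
  forall (e : val_exo L) (x : val_endo L),
    tauY (joint_eqn L x e) = joint_eqn H (tauY x) (tauU e).

(* [t] computes the [Z]-component of [tau] from the variables in [S]. *)
Definition component_map (T T' : Type) (D : T -> Type) (D' : T' -> Type)
    (tau : (forall X, D X) -> (forall Z, D' Z)) (Z : T') (S : set T)
    (t : setting D S -> D' Z) : Prop :=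
  forall x, tau x Z = t (proj_on x S).

(* As [Pi (inl Y)] contains only endogenous variables, it is the same set as
   [inl @^-1` Pi (inl Y)], and similarly for [Pi (inr U)]. *)
Definition alignment (R : realType) (L H : scm R)
    (tauY : val_endo L -> val_endo H) (tauU : val_exo L -> val_exo H)
    (Pi : endo H + exo H -> set (endo L + exo L)) : Prop :=
  (forall Y : endo H, Pi (inl Y) `<=` range inl /\
     exists t : setting (@endo_dom R L) (inl @^-1` Pi (inl Y)) -> endo_dom Y,
       component_map tauY t) /\
  (forall U : exo H, Pi (inr U) `<=` range inr /\
     exists t : setting (@exo_dom R L) (inr @^-1` Pi (inr U)) -> exo_dom U,
       component_map tauU t).

(* Main.v *)
Require Import Defs.
From mathcomp Require Import all_boot all_order all_algebra.
From mathcomp Require Import all_classical all_reals.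
From mathcomp Require Import measure.

Set Implicit Arguments.
Unset Strict Implicit.
Unset Printing Implicit Defensive.

Local Open Scope classical_set_scope.

(** Commutation read at a component [Y] targeted by [omega i] expresses the mechanism at
    [(tauY x, tauU e)] as the [Y]-component of the abstracted low-level output ([mechE]). Evaluating
    at partial inverses gives the formula. To locate the targets, compare [mechE] with commutation
    of the unintervened models: if [i] leaves the equations in [Pi (inl Y)] alone, the mechanism and
    the original equation of [Y] agree on all abstracted inputs, hence everywhere by surjectivity,
    against [mech_changed]. *)

Lemma override_target (R : realType) (M : scm R) (i : soft_intervention M)
    (X : target i) (x : val_endo M) (e : val_exo M) :
  override (mech i) (sval X) x e = mech i X x e.
Proof.
rewrite /override; case: pselect => [XV|]; last by case; exact: (svalP X).
(* [X] carries its own membership proof, [override] the one found by [pselect]; both prove a boolean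
   equality, so they coincide. *)
by case: X XV => X XV XV' /=; rewrite (bool_irrelevance XV' XV).
Qed.

Lemma override_notin (R : realType) (M : scm R) (i : soft_intervention M)
    (X : endo M) (x : val_endo M) (e : val_exo M) :
  ~ target i X -> override (mech i) X x e = struct_eqn X x e.
Proof.
rewrite /override; case: pselect => // XV notVX.
by case: notVX; exact: set_mem XV.
Qed.

Lemma surjectiveP (A B : Type) (f : A -> B) (b : B) :
  surjective f -> exists a, f a = b.
Proof. by move=> /(_ b I)[a _ <-]; exists a. Qed.

Theorem theorem2 (R : realType) (L H : scm R)
    (I : set (soft_intervention L)) (J : set (soft_intervention H))
    (tauY : val_endo L -> val_endo H) (tauU : val_exo L -> val_exo H)
    (omega : I -> J) (Pi : endo H + exo H -> set (endo L + exo L))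
    (habs : soft_abstraction_by tauY tauU omega)
    (hPi : alignment tauY tauU Pi)
    (i : I) :
  (commutes_unintervened tauY tauU ->
   target (sval (omega i)) `<=`
     [set Y | ([set inl X | X in target (sval i)] `&` Pi (inl Y)) !=set0]) /\
  (forall (Y : target (sval (omega i)))
     (tau_Y : setting (@endo_dom R L) (inl @^-1` Pi (inl (sval Y))) ->
              endo_dom (sval Y))
     (htau_Y : component_map tauY tau_Y)
     (tauY_inv : val_endo H -> val_endo L) (tauU_inv : val_exo H -> val_exo L)
     (htauY_inv : cancel tauY_inv tauY) (htauU_inv : cancel tauU_inv tauU)
     (y : val_endo H) (u : val_exo H),
     mech (sval (omega i)) Y y u =
     tau_Y (proj_on (joint_eqn (intervene (sval i)) (tauY_inv y) (tauU_inv u))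
              (inl @^-1` Pi (inl (sval Y))))).
Proof.
case: habs => surjY surjU _ _ commute.
have mechE (Y : target (sval (omega i))) x e :
    mech (sval (omega i)) Y (tauY x) (tauU e) =
    tauY (joint_eqn (intervene (sval i)) x e) (sval Y).
  by rewrite commute /joint_eqn /= override_target.
split=> [commute0 Y WY|Y tau_Y htau_Y tauY_inv tauU_inv tauYK tauUK y u].
  (* Otherwise [i] changes no equation in [Pi Y], on which alone the
     [Y]-component of [tauY] depends, so [omega i] cannot change that of [Y]. *)
  apply: contrapT => disj.
  pose Y' : target (sval (omega i)) := exist _ Y (mem_set WY).
  (* The point where the equation of [Y] must change is lifted to a low-level one, where commutation
     applies. *)
  have [y [u]] := mech_changed Y'; apply.
  have [x <-] := surjectiveP y surjY; have [e <-] := surjectiveP u surjU.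
  rewrite mechE.
  transitivity (tauY (joint_eqn L x e) Y); last by rewrite commute0.
  have [_ [t tE]] := hPi.1 Y.
  rewrite !tE; congr t; apply: functional_extensionality_dep => -[X PiX].
  apply: override_notin => VX; apply: disj.
  by exists (inl X); split; [exists X|exact: set_mem PiX].
(* This is [mechE] at preimages of [y] and [u]; any choice of preimages will do. *)
by rewrite -htau_Y -mechE tauYK tauUK.
Qed.
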